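(* For every even integer $n\ge 12$, both $K_{1,n}$ and $K^+_{1,n}$ are Ramsey-full, but neither $K_{1,n}$ nor $K^+_{1,n}$ is Gallai-Ramsey-full.
   Context: Graphs are finite and simple. $K_{1,n}$ is the star on $n+1$ vertices, and $K^+_{1,n}$ is the graph obtained from $K_{1,n}$ by subdividing one edge (a tree with $n+2$ vertices and maximum degree $n$). $K_N-e$ denotes the complete graph $K_N$ with one edge removed. $R(H,H)$ is the smallest positive integer $N$ such that every red-blue coloring of $E(K_N)$ contains a monochromatic copy of $H$. With $N=R(H,H)$, the graph $H$ is called Ramsey-full if there exists a red-blue edge coloring of $K_N-e$ containing neither a red copy of $H$ nor a blue copy of $H$. A Gallai coloring of a graph is an edge coloring that contains no rainbow triangle, i.e. no triangle whose three edges have three pairwise different colors. For a positive integer $k$, $GR_k(H)$ is the smallest positive integer $N$ such that every Gallai coloring $\tau:E(K_N)\to\{1,\dots,k\}$ (not all colors need be used) contains a monochromatic copy of $H$. For a given $k$, with $N=GR_k(H)$, the $k$-tuple $(H,\dots,H)$ is called Gallai-Ramsey-full if there exists a Gallai coloring of $K_N-e$ with colors from $\{1,\dots,k\}$ containing no monochromatic copy of $H$. The graph $H$ is called Gallai-Ramsey-full if for every $k\ge 2$ the $k$-tuple $(H,\dots,H)$ is Gallai-Ramsey-full. *)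

(* Defs.v *)
From mathcomp Require Import all_boot.

Set Implicit Arguments.
Unset Strict Implicit.
Unset Printing Implicit Defensive.

Record sgraph := SGraph {
  vertex :> finType;
  adj : rel vertex;
  adj_sym : symmetric adj;
  adj_irr : irreflexive adj }.

Section Constructions.

Lemma complete_sym N : symmetric (fun i j : 'I_N => i != j).
Proof. by move=> i j; rewrite eq_sym. Qed.

Lemma complete_irr N : irreflexive (fun i j : 'I_N => i != j).
Proof. by move=> i; rewrite eqxx. Qed.

Definition complete N : sgraph := SGraph (@complete_sym N) (@complete_irr N).

Variables (G : sgraph) (u v : G).

Definition delete_rel : rel G :=
  fun x y => adj x y && ([set x; y] != [set u; v]).

Lemma delete_sym : symmetric delete_rel.
Proof. by move=> x y; rewrite /delete_rel adj_sym setUC. Qed.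

Lemma delete_irr : irreflexive delete_rel.
Proof. by move=> x; rewrite /delete_rel adj_irr. Qed.

Definition delete_edge : sgraph := SGraph delete_sym delete_irr.

(* [None] is the new vertex placed on the edge uv. *)
Definition subdivide_rel : rel (option G) := fun x y =>
  match x, y with
  | Some a, Some b => delete_rel a b
  | None, Some a | Some a, None => a \in [set u; v]
  | None, None => false
  end.

Lemma subdivide_sym : symmetric subdivide_rel.
Proof. by move=> [a|] [b|] //=; exact: delete_sym. Qed.

Lemma subdivide_irr : irreflexive subdivide_rel.
Proof. by move=> [a|] //=; exact: delete_irr. Qed.

Definition subdivide : sgraph := SGraph subdivide_sym subdivide_irr.

End Constructions.

(* K_{1,n}, with centre [ord0]. *)
Lemma star_sym n :
  symmetric (fun i j : 'I_n.+1 => (i == ord0) (+) (j == ord0)).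
Proof. by move=> i j; rewrite addbC. Qed.

Lemma star_irr n :
  irreflexive (fun i j : 'I_n.+1 => (i == ord0) (+) (j == ord0)).
Proof. by move=> i; rewrite addbb. Qed.

Definition star n : sgraph := SGraph (@star_sym n) (@star_irr n).

(* K^+_{1,n}; the pair below is an edge of the star when n > 0. *)
Definition star_plus n : sgraph :=
  @subdivide (star n) (ord0 : 'I_n.+1) (ord_max : 'I_n.+1).

Section Colorings.

Variables (G : sgraph) (C : finType).

(* The colour of the edge xy is the value at [set x; y]; values at sets which
   are not edges of G are never consulted. *)
Definition coloring := {ffun {set G} -> C}.

(* The subgraph of G formed by the edges of colour a contains a (not
   necessarily induced) copy of H. *)
Definition has_copy (c : coloring) (a : C) (H : sgraph) : bool :=
  [exists f : {ffun H -> G}, injectiveb f &&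
    [forall x, forall y, adj x y ==>
       adj (f x) (f y) && (c [set f x; f y] == a)]].

Definition has_mono_copy (c : coloring) (H : sgraph) : bool :=
  [exists a, has_copy c a H].

Definition gallai (c : coloring) : bool :=
  [forall x, forall y, forall z,
     [&& adj x y, adj y z & adj x z] ==>
     ~~ uniq [:: c [set x; y]; c [set y; z]; c [set x; z]]].

End Colorings.

(* Ramsey's theorem for arbitrarily many colours, so that the minima below
   exist. *)
Section Ramsey.

Variable C : finType.

Lemma ramsey_clique (f : C -> nat) :
  exists N, forall (T : finType) (c : T -> T -> C) (A : {set T}),
    (forall x y, c x y = c y x) -> N <= #|A| ->
    exists a, exists B : {set T}, [/\ B \subset A, f a <= #|B| &
      {in B &, forall x y, x != y -> c x y = a}].
Proof.
have [m] := ubnP (\sum_a f a); elim: m f => // m IHm f lt_f_m.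
have [/existsP[a /eqP fa0] | /existsPn f_gt0] := boolP [exists a, f a == 0].
  exists 0 => T c A _ _; exists a, set0.
  by split=> [||x y]; rewrite ?sub0set ?fa0 ?inE.
pose g a b := if b == a then (f a).-1 else f b.
have IHg a : exists N, forall (T : finType) (c : T -> T -> C) (A : {set T}),
    (forall x y, c x y = c y x) -> N <= #|A| ->
    exists b, exists B : {set T}, [/\ B \subset A, g a b <= #|B| &
      {in B &, forall x y, x != y -> c x y = b}].
  apply: IHm; rewrite ltnS in lt_f_m; apply: leq_trans lt_f_m.
  rewrite (bigD1 a) // [X in _ < X](bigD1 a) //= /g eqxx.
  rewrite (eq_bigr f) => [|b /negPf-> //].
  by have := f_gt0 a; case: (f a).
have [h hP] := fin_all_exists IHg.
exists (\sum_a h a).+1 => T c A c_sym leA.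
have /card_gt0P[v vA]: 0 < #|A| by exact: leq_trans leA.
pose D a := [set x in A :\ v | c v x == a].
have sumD : \sum_a #|D a| = #|A :\ v|.
  rewrite -sum1_card (partition_big (c v) xpredT) //=.
  by apply: eq_bigr => a _; rewrite -sum1_card; apply: eq_bigl => x; rewrite !inE.
have [a leDa]: exists a, h a <= #|D a|.
  apply/existsP; apply: contraLR leA => /existsPn ltD.
  rewrite (cardsD1 v A) vA ltnS -sumD -ltnNge.
  rewrite (bigD1 (c v v)) // [X in _ < X](bigD1 (c v v)) //= -addSn.
  by apply: leq_add; [|apply: leq_sum => b _; rewrite ltnW //]; rewrite ltnNge ltD.
have [b [B [sBD leB monoB]]] := hP a T c (D a) c_sym leDa.
have sBA : B \subset A.
  by apply: subset_trans sBD _; apply/subsetP => x; rewrite !inE => /andP[/andP[]].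
move: leB; rewrite /g; case: eqP => [eq_ba leB | _ leB]; last by exists b, B.
subst b; have vB : v \notin B.
  by apply/negP => /(subsetP sBD); rewrite !inE eqxx.
exists a, (v |: B); split.
- by rewrite subUset sub1set vA.
- by rewrite cardsU1 vB; have := f_gt0 a; case: (f a) leB.
have cvB x : x \in B -> c v x = a.
  by move/(subsetP sBD); rewrite !inE => /andP[_ /eqP].
move=> x y /setU1P[->|xB] /setU1P[->|yB]; rewrite ?eqxx // => neq.
- exact: cvB.
- by rewrite c_sym cvB.
exact: monoB.
Qed.

Lemma ramsey_exists (H : sgraph) :
  exists N, (0 < N) && [forall c : coloring (complete N) C, has_mono_copy c H].
Proof.
have [N NP] := ramsey_clique (fun _ => #|H|).
exists N.+1; apply/forallP => c.
have [||a [B [_ leB monoB]]] :=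
    NP 'I_N.+1 (fun x y => c [set x; y]) [set: 'I_N.+1].
- by move=> x y; rewrite setUC.
- by rewrite cardsT card_ord.
have rankP (x : H) : enum_rank x < size (enum B).
  by rewrite -cardE; apply: leq_trans (ltn_ord _) leB.
apply/existsP; exists a; apply/existsP.
exists [ffun x : H => nth ord0 (enum B) (enum_rank x)].
have inj_f : injective [ffun x : H => nth ord0 (enum B) (enum_rank x)].
  move=> x y; rewrite !ffunE => /eqP.
  by rewrite nth_uniq ?enum_uniq // => /eqP/val_inj/enum_rank_inj.
apply/andP; split; first exact/injectiveP.
apply/forallP => x; apply/forallP => y; apply/implyP => xy.
have neq: [ffun x : H => nth ord0 (enum B) (enum_rank x)] x
       != [ffun x : H => nth ord0 (enum B) (enum_rank x)] y.
  by apply: contraTneq xy => /inj_f->; rewrite adj_irr.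
rewrite /= neq /=; apply/eqP; apply: monoB => //.
  by rewrite ffunE -mem_enum mem_nth.
by rewrite ffunE -mem_enum mem_nth.
Qed.

End Ramsey.

Lemma gallai_ramsey_exists k (H : sgraph) :
  exists N, (0 < N) && [forall c : coloring (complete N) 'I_k,
                          gallai c ==> has_mono_copy c H].
Proof.
have [N /andP[N_gt0 /forallP NP]] := ramsey_exists 'I_k H.
by exists N; rewrite N_gt0; apply/forallP => c; rewrite NP implybT.
Qed.

(* R(H,H); the two colours are the booleans. *)
Definition ramsey_number (H : sgraph) : nat := ex_minn (ramsey_exists bool H).

(* GR_k(H) *)
Definition gallai_ramsey_number (k : nat) (H : sgraph) : nat :=
  ex_minn (gallai_ramsey_exists k H).

Definition ramsey_full (H : sgraph) : Prop :=
  let K := complete (ramsey_number H) in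
  exists u v : K, adj u v /\
    exists c : coloring (delete_edge u v) bool,
      ~~ has_copy c true H /\ ~~ has_copy c false H.

Definition gallai_ramsey_full_at (k : nat) (H : sgraph) : Prop :=
  let K := complete (gallai_ramsey_number k H) in
  exists u v : K, adj u v /\
    exists c : coloring (delete_edge u v) 'I_k,
      gallai c /\ ~~ has_mono_copy c H.

Definition gallai_ramsey_full (H : sgraph) : Prop :=
  forall k, 2 <= k -> gallai_ramsey_full_at k H.

(* Main.v *)
Require Import Defs.
From mathcomp Require Import all_boot zify.

(* Write n = 2m.  For two colours, on 2n-1 vertices without a monochromatic
   star all colour degrees would equal n-1, against parity; deleting one edge
   removes the obstruction.  For three colours both Gallai-Ramsey numbers are
   5m-3, a pentagon blow-up giving the lower bound.  Let K_{5m-3} - uv be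
   Gallai-coloured with all colour degrees below n.  Without u, some colour g is
   disconnected, and the edges between two g-components have a single colour
   other than g.  Degrees force components of order at least m-2 and (this needs
   m >= 6) at most two neighbouring components in each colour, hence a pentagon
   blow-up with parts of orders m, m-1, m-1, m-1, m-1, whose colours are
   saturated.  One edge of colour g at u then propagates to almost all edges at
   u, while u cannot live with the two other colours only.  Finally a
   monochromatic star of order n+1 extends to a subdivided one, for otherwise the
   vertices outside it see it uniformly, each in a colour of its own. *)

Set Implicit Arguments.
Unset Strict Implicit.
Unset Printing Implicit Defensive.

(* The preprocessing of [lia] turns every boolean hypothesis into an atom, on
   which it then splits; only the numerical ones are kept. *)
Ltac num_lia :=
  repeat match goal with H : ?P |- _ =>
    lazymatch type of P with Prop =>
      lazymatch P with
      | is_true (leq _ _) => fail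
      | is_true (leq _ _ && leq _ _) => fail
      | is_true (~~ odd _) => fail
      | is_true (~~ leq _ _) => fail
      | @eq nat _ _ => fail
      | _ => clear H
      end
    end
  end; lia.

(** * Cardinalities of finite sets and parity of degree sums *)

Lemma subset_card_exists (T : finType) (A : {set T}) k :
  k <= #|A| -> exists2 B : {set T}, B \subset A & #|B| = k.
Proof.
elim: k => [|k IHk] ltkA; first by exists set0; rewrite ?sub0set ?cards0.
have [B sBA cardB] := IHk (ltnW ltkA).
have /card_gt0P[x] : 0 < #|A :\: B|.
  by rewrite cardsD (setIidPr sBA) cardB subn_gt0.
rewrite inE => /andP[xB xA]; exists (x |: B).
  by rewrite subUset sub1set xA.
by rewrite cardsU1 xB cardB.
Qed.

Lemma card_ge2_exists (T : finType) (A : {set T}) :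
  2 <= #|A| -> exists x y, [/\ x \in A, y \in A & x != y].
Proof.
move=> A2; have /card_gt0P[x xA] : 0 < #|A| by exact: ltnW.
have /card_gt0P[y] : 0 < #|A :\ x| by move: A2; rewrite (cardsD1 x) xA.
by rewrite !inE => /andP[yx yA]; exists x, y; rewrite eq_sym.
Qed.

Lemma leq_card_cover2 (T : finType) (S A B : {set T}) :
  S \subset A :|: B -> #|S| <= #|A| + #|B|.
Proof. by move/subset_leq_card/leq_trans; apply; rewrite cardsU leq_subr. Qed.

Lemma leq_cardsU (T : finType) (A B : {set T}) : #|A :|: B| <= #|A| + #|B|.
Proof. exact: leq_card_cover2. Qed.

Lemma leq_cardD (T : finType) (A B : {set T}) k :
  #|B| <= k -> #|A| - k <= #|A :\: B|.
Proof.
move=> Bk; rewrite leq_subLR -(cardsID B A) leq_add2r.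
exact: leq_trans (subset_leq_card (subsetIr A B)) Bk.
Qed.

Lemma leq_cards2 (T : finType) (x y : T) : #|[set x; y]| <= 2.
Proof. by rewrite cards2; case: (x != y). Qed.

Lemma leq_cards3 (T : finType) (x y z : T) : #|[set x; y; z]| <= 3.
Proof.
apply: leq_trans (leq_cardsU _ _) _; rewrite cards1 addn1 ltnS.
exact: leq_cards2.
Qed.

Lemma leq_cards4 (T : finType) (x y z t : T) : #|[set x; y] :|: [set z; t]| <= 4.
Proof.
apply: leq_trans (leq_cardsU _ _) _.
exact: leq_add (leq_cards2 x y) (leq_cards2 z t).
Qed.

(** Induction on [S]: removing [w] lowers the sum by the degree of [w] and by one more for each
    neighbour of [w], hence by an even number. *)
Lemma handshake (T : finType) (e : rel T) (S : {set T}) :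
  symmetric e -> irreflexive e ->
  ~~ odd (\sum_(x in S) #|[set y in S | e x y]|).
Proof.
move=> e_sym e_irr; under eq_bigr => x _.
  rewrite -sum1dep_card big_mkcondr /=.
  under eq_bigr => y _ do have -> : (if e x y then 1 else 0) = e x y by case: (e x y).
  over.
have [k] := ubnP #|S|; elim: k S => // k IHk S.
have [->|[w wS]] := set_0Vmem S; first by rewrite big_set0.
rewrite (cardsD1 w S) wS add1n ltnS => /IHk IH.
rewrite (big_setD1 w wS) (big_setD1 w wS) /= e_irr add0n.
under [X in _ + X]eq_bigr => x _ do rewrite (big_setD1 w wS) e_sym /=.
by rewrite big_split /= addnA addnn oddD odd_double.
Qed.

(** * Monochromatic stars and subdivided stars *)

Section Copies.

Variables (G : sgraph) (C : finType).
Implicit Types (c : coloring G C) (a : C).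

Definition nbhd c a (v : G) : {set G} := [set y | adj v y && (c [set v; y] == a)].

Lemma in_nbhd c a (v y : G) : (y \in nbhd c a v) = adj v y && (c [set v; y] == a).
Proof. by rewrite inE. Qed.

Lemma nbhd_sym c a (v y : G) : (y \in nbhd c a v) = (v \in nbhd c a y).
Proof. by rewrite !in_nbhd adj_sym setUC. Qed.

Lemma nbhd_irr c a (v : G) : (v \in nbhd c a v) = false.
Proof. by rewrite in_nbhd adj_irr. Qed.

Lemma has_copyP c a (H : sgraph) :
  reflect (exists2 f : H -> G, injective f &
             forall x y, adj x y -> f y \in nbhd c a (f x))
          (has_copy c a H).
Proof.
apply: (iffP existsP) => [[f /andP[/injectiveP f_inj /forallP f_adj]]|].
  exists f => // x y xy; rewrite in_nbhd.
  by have /forallP/(_ y)/implyP/(_ xy) := f_adj x.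
case=> f f_inj f_adj; exists [ffun x => f x]; apply/andP; split.
  by apply/injectiveP => x y; rewrite !ffunE => /f_inj.
apply/forallP => x; apply/forallP => y; apply/implyP => /f_adj.
by rewrite !ffunE in_nbhd.
Qed.

Lemma copy_starP c a n :
  reflect (exists v, n <= #|nbhd c a v|) (has_copy c a (star n)).
Proof.
apply: (iffP (has_copyP c a (star n))) => [[f f_inj f_adj]|[v nv]].
  exists (f ord0); pose h (i : 'I_n) := f (lift ord0 i).
  have h_inj : injective h by move=> i j /f_inj/lift_inj.
  rewrite -[n in n <= _]card_ord -(card_imset _ h_inj).
  by apply/subset_leq_card/subsetP => _ /imsetP[i _ ->]; apply: f_adj.
pose L := enum (nbhd c a v).
have nL (i : 'I_n.+1) : i != ord0 -> i.-1 < size L.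
  move=> i0; rewrite -cardE; apply: leq_trans nv.
  by have := ltn_ord i; rewrite -val_eqE /= in i0; lia.
have memL (i : 'I_n.+1) : i != ord0 -> nth v L i.-1 \in nbhd c a v.
  by move=> i0; rewrite -mem_enum mem_nth ?nL.
exists (fun i : 'I_n.+1 => if i == ord0 then v else nth v L i.-1) => /= [i j|i j].
  case: (altP eqP) => [->|i0]; case: (altP eqP) => [->|j0] //.
  - by move=> E; have := memL j j0; rewrite -E nbhd_irr.
  - by move=> E; have := memL i i0; rewrite E nbhd_irr.
  move/eqP; rewrite nth_uniq ?enum_uniq ?nL // => /eqP E; apply/val_inj.
  by move: i0 j0; rewrite -!val_eqE /=; lia.
case: (altP (i =P ord0)) => i0; case: (altP (j =P ord0)) => j0 //= _.
  exact: memL.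
by rewrite nbhd_sym memL.
Qed.

(** For positive [n], the subdividing vertex [None] takes the place of the lost leaf [ord_max], so
    the centre still has [n] neighbours. *)
Lemma star_plus_star c a n : has_copy c a (star_plus n) -> has_copy c a (star n).
Proof.
case: n => [|n].
  move=> /existsP[f _]; apply/copy_starP; exists (f None).
  exact: leq0n.
case/has_copyP => f f_inj f_adj; apply/copy_starP; exists (f (Some ord0)).
pose h (i : 'I_n.+1) := f (if i == ord_max then None else Some (lift ord0 i)).
have h_inj : injective h.
  move=> i j /f_inj; case: (altP eqP) => [->|_]; case: (altP eqP) => [->|_] //.
  by move/Some_inj/lift_inj.
have cardh : #|[set h i | i in 'I_n.+1]| = n.+1 by rewrite card_imset ?card_ord.
apply: (leq_trans (eq_leq (esym cardh))).
apply/subset_leq_card/subsetP => _ /imsetP[i _ ->]; apply: f_adj.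
case: (altP eqP) => [_ /=|i_max]; first by rewrite !inE eqxx.
rewrite /= /delete_rel /=; apply/eqP => /setP /(_ (lift ord0 i)).
rewrite !inE eqxx orbT /= => /esym/eqP/val_eqP /=.
by rewrite -val_eqE /= in i_max; rewrite /bump /= add1n eqSS (negPf i_max).
Qed.

(** Here [v] is the centre, [x] the subdividing vertex and [y] the end of the long branch. *)
Lemma copy_star_plus c a n v x y :
  0 < n -> x \in nbhd c a v -> y \in nbhd c a x -> y != v ->
  n.-1 <= #|nbhd c a v :\: [set x; y]| -> has_copy c a (star_plus n).
Proof.
case: n => // n _ vx xy yv /= nv; apply/has_copyP.
pose L := enum (nbhd c a v :\: [set x; y]).
have nL (i : 'I_n.+2) : i != ord0 -> i != ord_max -> i.-1 < size L.
  move=> i0 i1; rewrite -cardE; apply: leq_trans nv.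
  by have := ltn_ord i; rewrite -!val_eqE /= in i0 i1; lia.
have memL (i : 'I_n.+2) : i != ord0 -> i != ord_max ->
    nth v L i.-1 \in nbhd c a v :\: [set x; y].
  by move=> i0 i1; rewrite -mem_enum mem_nth ?nL.
pose f (i : option 'I_n.+2) := if i is Some i then
  if i == ord0 then v else if i == ord_max then y else nth v L i.-1 else x.
have xv : x != v by apply: contraTneq vx => ->; rewrite nbhd_irr.
have yx : y != x by apply: contraTneq xy => ->; rewrite nbhd_irr.
have Lneq (i : 'I_n.+2) : i != ord0 -> i != ord_max ->
    [/\ nth v L i.-1 != v, nth v L i.-1 != x & nth v L i.-1 != y].
  move=> i0 i1; have := memL i i0 i1; rewrite in_setD in_set2 negb_or -andbA.
  by case/and3P=> -> -> vi; split=> //; apply: contraTneq vi => ->; rewrite nbhd_irr.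
have f_inj : injective f.
  move=> [i|] [j|] //=.
  - case: (altP (i =P ord0)) => [->|i0]; case: (altP (j =P ord0)) => [->|j0] //.
    + case: (altP eqP) => [_ E|j1 E]; first by rewrite E eqxx in yv.
      by have [] := Lneq j j0 j1; rewrite -E eqxx.
    + case: (altP eqP) => [_ E|j1 E]; first by rewrite E eqxx in yv.
      by have [] := Lneq i i0 j1; rewrite E eqxx.
    case: (altP (i =P ord_max)) => [->|i1];
      case: (altP (j =P ord_max)) => [->|j1] //.
    + by move=> E; have [] := Lneq j j0 j1; rewrite -E eqxx.
    + by move=> E; have [] := Lneq i i0 i1; rewrite E eqxx.
    move/eqP; rewrite nth_uniq ?enum_uniq ?nL // => /eqP E; congr Some.
    by apply/val_inj; move: i0 j0; rewrite -!val_eqE /=; lia.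
  - case: (altP eqP) => [_ E|i0]; first by rewrite E eqxx in xv.
    case: (altP eqP) => [_ E|i1 E]; first by rewrite E eqxx in yx.
    by have [] := Lneq i i0 i1; rewrite E eqxx.
  - case: (altP eqP) => [_ E|i0]; first by rewrite E eqxx in xv.
    case: (altP eqP) => [_ E|i1 E]; first by rewrite E eqxx in yx.
    by have [] := Lneq j i0 i1; rewrite E eqxx.
have f_ord (i j : 'I_n.+2) : i = ord0 -> j != ord0 ->
    [set i; j] != [set ord0; ord_max] -> f (Some j) \in nbhd c a (f (Some i)).
  move=> -> j0 j1; rewrite /= (negPf j0); case: (altP (j =P ord_max)) j1 => [->|j1 _].
    by rewrite eqxx.
  by have := memL j j0 j1; rewrite in_setD => /andP[].
have f_mid i : i \in [set ord0; ord_max] -> f (Some i) \in nbhd c a x.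
  by rewrite in_set2 => /orP[]/eqP->; rewrite /= ?eqxx // nbhd_sym.
exists f => // -[i|] [j|] //=.
- case/andP=> /=; case: (altP (i =P ord0)) => [i0|i0];
    case: (altP (j =P ord0)) => [j0|j0] //= _ Ne.
    by have := f_ord i j i0 j0 Ne; rewrite /f (negPf j0) i0 eqxx.
  rewrite setUC in Ne; have := f_ord j i j0 i0 Ne.
  by rewrite nbhd_sym /f (negPf i0) j0 eqxx.
- by move/f_mid; rewrite nbhd_sym.
exact: f_mid.
Qed.

(** * Subdivided stars in two-coloured complete graphs *)

Definition clique (S : {set G}) := {in S &, forall x y, x != y -> adj x y}.

Lemma card_two_colors c r b (S : {set G}) v :
  (forall y, y \in S -> (y \in nbhd c r v) || (y \in nbhd c b v)) ->
  #|S| <= #|nbhd c r v :&: S| + #|nbhd c b v :&: S|.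
Proof.
move=> col; apply: leq_card_cover2; apply/subsetP => y yS.
by rewrite in_setU !in_setI yS !andbT col.
Qed.

(** Suppose there is no [a]-copy. If [D] has more than [n] elements, its vertices send only
    [b]-edges to vertices other than [v]. If it has exactly [n], this holds for edges leaving [D],
    and a vertex outside [v |: D] is [b]-joined to all of [v |: D]. *)
Lemma two_colored_star_plus c a b n (S : {set G}) v :
  4 <= n -> #|S| = n.*2.-1 ->
  {in S &, forall x y, x != y -> (y \in nbhd c a x) || (y \in nbhd c b x)} ->
  v \in S -> n <= #|nbhd c a v :&: S| ->
  has_copy c a (star_plus n) || has_copy c b (star_plus n).
Proof.
move=> n4 cardS col vS; set D := nbhd c a v :&: S => nD.
apply: contraT; rewrite negb_or => /andP[no_a no_b].
have n0 : 0 < n by num_lia.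
have sDS : D \subset S by apply: subsetIr.
have vD : v \notin D by rewrite in_setI nbhd_irr.
have bD x y : x \in D -> y \in S -> y != x -> y != v ->
    (n < #|D|) || (y \notin D) -> y \in nbhd c b x.
  rewrite in_setI => /andP[vx xS] yS yx yv Dy.
  have := col x y xS yS; rewrite eq_sym => /(_ yx)/orP[xy|//].
  case/negP: no_a; apply: (copy_star_plus n0 vx xy yv).
  apply: leq_trans (_ : #|D :\: [set x; y]| <= _); last first.
    by apply/subset_leq_card/setSD/subsetIl.
  case/orP: Dy => Dy.
    by apply: leq_trans (leq_cardD D (leq_cards2 x y)); num_lia.
  suff Dxy : #|D :&: [set x; y]| <= 1.
    by rewrite cardsD; apply: leq_trans (leq_sub2l #|D| Dxy); num_lia.
  rewrite -(cards1 x); apply/subset_leq_card/subsetP => z.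
  rewrite in_setI in_set2 in_set1 => /andP[zD /orP[//|/eqP zy]].
  by rewrite -zy zD in Dy.
have [ltnD|leDn] := ltnP n #|D|.
  have [x [y [xD yD xy]]] : exists x y, [/\ x \in D, y \in D & x != y].
    by apply: card_ge2_exists; num_lia.
  have xS := subsetP sDS _ xD; have yS := subsetP sDS _ yD.
  have xv : x != v by apply: contraNneq vD => <-.
  have yv : y != v by apply: contraNneq vD => <-.
  have /card_gt0P[z] : 0 < #|S :\: [set v; x; y]|.
    by apply: leq_trans (leq_cardD S (leq_cards3 v x y)); rewrite cardS; num_lia.
  rewrite !inE !negb_or -!andbA => /and4P[zv zx zy zS].
  case/negP: no_b; apply: (@copy_star_plus c b n x y z) => //.
  - by apply: bD; rewrite ?ltnD // eq_sym.
  - by apply: bD; rewrite ?ltnD.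
  (* Four of the [2n-1] vertices are set aside, and [2n-5] is at least [n-1] because [4 <= n]. *)
  have sub : S :\: ([set x; y] :|: [set v; z]) \subset nbhd c b x :\: [set y; z].
    apply/subsetP => s; rewrite !in_setD in_setU !in_set2 !negb_or -!andbA.
    by case/and5P=> sx sy sv sz sS; rewrite sy sz; apply: bD; rewrite ?ltnD.
  apply: leq_trans (subset_leq_card sub).
  by apply: leq_trans (leq_cardD S (leq_cards4 x y v z)); rewrite cardS; num_lia.
(* Now [D] has exactly [n] elements and [n-2] vertices remain, enough for a centre [w] and the end
   [w'] of its long branch. *)
have cardW : #|S :\: (v |: D)| = #|S| - #|D|.+1.
  by rewrite cardsD (setIidPr _) ?cardsU1 ?vD // subUset sub1set vS.
have [w [w' [wW w'W ww']]] : exists w w', [/\ w \in S :\: (v |: D),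
    w' \in S :\: (v |: D) & w != w'] by apply: card_ge2_exists; num_lia.
move: wW w'W; rewrite !(in_setD, in_setU1) !negb_or -!andbA.
move=> /and3P[wv wD wS] /and3P[w'v w'D w'S].
have /card_gt0P[x xD] : 0 < #|D| by apply: leq_trans nD.
have wb y : y \in D -> y \in nbhd c b w.
  by move=> yD; rewrite nbhd_sym; apply: bD; rewrite ?wD ?orbT //; apply: contraNneq wD => ->.
have wbv : v \in nbhd c b w.
  have := col w v wS vS; rewrite wv => /(_ isT)/orP[|//].
  by move=> vw; move: wD; rewrite in_setI wS nbhd_sym vw.
case/negP: no_b; apply: (@copy_star_plus c b n w x w') => //.
- exact: wb.
- by apply: bD; rewrite ?w'D ?orbT //; apply: contraNneq w'D => ->.
- by rewrite eq_sym.
have sub : (v |: D) :\ x \subset nbhd c b w :\: [set x; w'].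
  apply/subsetP => s; rewrite !(in_setD, in_setU1, in_set1, in_set2) negb_or.
  case/andP=> sx svD; rewrite sx /=; apply/andP; split.
    by apply: contraTneq svD => ->; rewrite negb_or w'v.
  by case/orP: svD => [/eqP->|/wb].
apply: leq_trans (subset_leq_card sub).
have := cardsD1 x (v |: D); rewrite cardsU1 vD in_setU1 xD orbT /= !add1n => -[<-].
exact: leq_trans (leq_pred n) nD.
Qed.

(** If no vertex has [n] neighbours in one colour, then within a subset of [2n-1] vertices all
    degrees are exactly [n-1] in both colours; an odd number of odd degrees contradicts
    [handshake]. *)
Lemma two_colored_clique_star_plus c r b n (S : {set G}) :
  4 <= n -> ~~ odd n -> n.*2.-1 <= #|S| -> r != b ->
  {in S &, forall x y, x != y -> (y \in nbhd c r x) || (y \in nbhd c b x)} ->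
  has_copy c r (star_plus n) || has_copy c b (star_plus n).
Proof.
move=> n4 nev nS rb colS; have [S' sS'S cardS'] := subset_card_exists nS.
have col : {in S' &, forall x y, x != y -> (y \in nbhd c r x) || (y \in nbhd c b x)}.
  by move=> x y xS yS; apply: colS; apply: (subsetP sS'S).
have colC : {in S' &, forall x y, x != y -> (y \in nbhd c b x) || (y \in nbhd c r x)}.
  by move=> x y xS yS; rewrite orbC; apply: col.
have [/existsP[v /andP[vS nv]]|/existsPn no_r] :=
  boolP [exists v, (v \in S') && (n <= #|nbhd c r v :&: S'|)].
  exact: (two_colored_star_plus n4 cardS' col vS nv).
have [/existsP[v /andP[vS nv]]|/existsPn no_b] :=
  boolP [exists v, (v \in S') && (n <= #|nbhd c b v :&: S'|)].
  by rewrite orbC; exact: (two_colored_star_plus n4 cardS' colC vS nv).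
have e_sym : symmetric (fun x y => y \in nbhd c r x).
  by move=> x y; rewrite nbhd_sym.
have e_irr : irreflexive (fun x y => y \in nbhd c r x).
  by move=> x; rewrite nbhd_irr.
have := handshake S' e_sym e_irr.
have -> : \sum_(x in S') #|[set y in S' | y \in nbhd c r x]| = \sum_(x in S') n.-1.
  apply: eq_bigr => x xS; rewrite setIdE setIC; set N := [set y | _].
  have -> : N = nbhd c r x by apply/setP=> y; rewrite inE.
  have := no_r x; have := no_b x; rewrite xS /= -!ltnNge => bx rx.
  have : #|S' :\ x| <= #|nbhd c r x :&: (S' :\ x)| + #|nbhd c b x :&: (S' :\ x)|.
    apply: card_two_colors => y; rewrite in_setD1 => /andP[yx yS].
    by apply: col; rewrite // eq_sym.
  have := cardsD1 x S'; rewrite xS cardS'.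
  have sD a : #|nbhd c a x :&: (S' :\ x)| <= #|nbhd c a x :&: S'|.
    by apply/subset_leq_card/setIS/subsetDl.
  by have := sD r; have := sD b; num_lia.
rewrite sum_nat_const cardS' oddM.
have -> : odd n.*2.-1 by case: (n) n4 => // k _; rewrite doubleS /= odd_double.
by case: (n) n4 nev => // k _ /=; rewrite negbK => ->.
Qed.

End Copies.

(** * Gallai colourings and disconnected colour classes *)

Section GallaiStructure.

Variables (G : sgraph) (C : finType) (c : coloring G C).
Hypothesis gallai_c : gallai c.
Implicit Types (g a b : C) (S : {set G}).

Local Notation col x y := (c [set x; y]).

Lemma col_sym x y : col x y = col y x.
Proof. by rewrite setUC. Qed.

Lemma gallai_third x y z :
  adj x y -> adj y z -> adj x z ->
  col x y != col y z -> col x z != col x y -> col x z = col y z.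
Proof.
move=> xy yz xz ne1 ne2; move/forallP/(_ x)/forallP/(_ y)/forallP/(_ z): gallai_c.
rewrite xy yz xz /= !inE negb_or ne1 andbT.
by rewrite eq_sym (negPf ne2) /= negbK eq_sym => /eqP.
Qed.

(** Membership in [S] is built in, so that for vertices of [S] the classes of [connect] are the
    components of colour [g] inside [S]. *)
Definition mono_rel g S : rel G :=
  fun x y => [&& x \in S, y \in S & y \in nbhd c g x].

Lemma mono_connect_sym g S : connect_sym (mono_rel g S).
Proof.
move=> x y; have -> : connect (mono_rel g S) y x =
    connect (fun u v => mono_rel g S v u) x y by rewrite (connect_rev (mono_rel g S)).
by apply: eq_connect => u v; rewrite /mono_rel nbhd_sym andbCA.
Qed.

Lemma mono_connect_in g S x y : connect (mono_rel g S) x y -> x \in S -> y \in S.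
Proof.
have cl : closed (mono_rel g S) (mem S) by move=> u v /and3P[-> ->].
by move=> /(closed_connect cl) ->.
Qed.

Lemma unconnected_adj g S x y : clique S -> x \in S -> y \in S ->
  ~~ connect (mono_rel g S) x y -> adj x y && (col x y != g).
Proof.
move=> clS xS yS nxy.
have xy : x != y by apply: contraNneq nxy => ->; apply: connect0.
rewrite clS //=; apply: contraNneq nxy => xyg; apply: connect1.
by rewrite /mono_rel xS yS in_nbhd clS //= -xyg eqxx.
Qed.

(** Along a path of colour [g] from [y], the edges from [x] to two successive vertices avoid [g], so
    they agree for want of a rainbow triangle. *)
Lemma unconnected_col g S x y y' : clique S -> x \in S -> y \in S ->
  ~~ connect (mono_rel g S) x y -> connect (mono_rel g S) y y' ->
  col x y' = col x y.
Proof.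
move=> clS xS yS nxy /connectP[p p_path ->] {y'}.
elim: p y yS nxy p_path => //= z p IHp y yS nxy /andP[yz p_path].
have nxz : ~~ connect (mono_rel g S) x z.
  by apply: contra nxy => xz; apply: connect_trans xz _; rewrite mono_connect_sym connect1.
have /and3P[_ zS] := yz; rewrite in_nbhd => /andP[yz_adj /eqP yz_g].
rewrite IHp //; have /andP[xy xyg] := unconnected_adj clS xS yS nxy.
have /andP[xz xzg] := unconnected_adj clS xS zS nxz.
apply/eqP/negPn/negP => ne; case/negP: xzg.
by rewrite (gallai_third xy yz_adj xz) // yz_g.
Qed.

(* With at least three colours some colour class is disconnected: delete a
   vertex [w] at which all colours occur; if every class of the disconnected
   colour [g] of the rest received a [g]-edge from [w], then an edge [wp] of
   another colour would force that colour on all edges between [p] and the other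
   classes, which cannot hold for two colours at once. *)
Lemma gallai_disconnected S : 2 < #|C| -> clique S -> 1 < #|S| ->
  exists g x y, [/\ x \in S, y \in S & ~~ connect (mono_rel g S) x y].
Proof.
move=> C3; have [k] := ubnP #|S|; elim: k S => // k IHk S ltSk clS S2.
have /card_gt0P[w wS] : 0 < #|S| by exact: ltnW.
have cut g (A : {pred G}) y : w \in A -> y \in S -> y \notin A ->
    (forall p q, p \in A -> q \notin A -> ~~ mono_rel g S p q) ->
    exists g x y, [/\ x \in S, y \in S & ~~ connect (mono_rel g S) x y].
  move=> wA yS yA noA; exists g, w, y; split=> //.
  have cl : closed (mono_rel g S) A.
    apply: (intro_closed (mono_connect_sym g S)) => p q pq pA.
    by apply: contraLR pq => /noA; apply.
  by apply/negP => /(closed_connect cl); rewrite wA (negPf yA).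
have [/existsP[g /existsP[y /andP[/andP[yS yw] /forallP noq]]]|all_col] :=
  boolP [exists g, [exists y, (y \in S) && (y != w) &&
    [forall q, ~~ mono_rel g S w q]]].
  apply: (cut g (pred1 w) y); rewrite ?inE //.
  by move=> p q /eqP-> _; apply: noq.
have [y0 y0S y0w] : exists2 y, y \in S & y != w.
  have /card_gt0P[y] : 0 < #|S :\ w| by rewrite (cardsD1 w) wS in S2.
  by rewrite in_setD1 => /andP[yw yS]; exists y.
have all_w g : exists2 q, q \in S :\ w & col w q = g.
  have : ~~ [forall q, ~~ mono_rel g S w q].
    apply: contra all_col => noq; apply/existsP; exists g; apply/existsP.
    by exists y0; rewrite y0S y0w.
  case/forallPn => q; rewrite negbK => /and3P[_ qS]; rewrite in_nbhd.
  case/andP=> wq /eqP <-; exists q; rewrite // in_setD1 qS andbT.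
  by apply: contraTneq wq => ->; rewrite adj_irr.
set S' := S :\ w.
have sS : {subset S' <= S} by move=> x; rewrite in_setD1 => /andP[].
have wS' x : x \in S' -> adj w x.
  by move=> xS'; apply: clS => //; [exact: sS|move: xS'; rewrite in_setD1 eq_sym => /andP[]].
have cl' : clique S' by move=> x y /sS xS /sS yS; apply: clS.
have [g [x0 [y1 [x0S y1S n01]]]] : exists g x y,
    [/\ x \in S', y \in S' & ~~ connect (mono_rel g S') x y].
  apply: IHk => //; first by rewrite (cardsD1 w) wS in ltSk.
  have : 1 < #|[set: C]| by rewrite cardsT ltnW.
  case/card_ge2_exists => g1 [g2 [_ _ g12]].
  have [q1 q1S q1g] := all_w g1; have [q2 q2S q2g] := all_w g2.
  apply: leq_trans (_ : #|[set q1; q2]| <= _).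
    rewrite cards2; case: (eqVneq q1 q2) => // q12.
    by rewrite -q1g q12 q2g eqxx in g12.
  by apply/subset_leq_card/subsetP=> q /set2P[]->.
pose E := connect (mono_rel g S').
(* A class of [S'] that sends no [g]-edge to [w] remains a separate class in [S]. *)
have [/existsP[z /andP[zS' /forallP noz]]|allz] := boolP [exists z, (z \in S') &&
    [forall z', E z z' ==> (col w z' != g)]].
  apply: (cut g (predC (E z)) z); rewrite ?inE ?negbK.
  - apply/negP => /mono_connect_in/(_ zS').
    by rewrite in_setD1 eqxx.
  - exact: sS.
  - exact: connect0.
  move=> p q; rewrite !inE negbK => pz zq; apply/negP => /and3P[pS qS pq].
  have qS' := mono_connect_in zq zS'.
  have [p_w|pw] := eqVneq p w.
    by have := noz q; rewrite zq -p_w; move: pq; rewrite in_nbhd => /andP[_ ->].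
  case/negP: pz; apply: connect_trans zq _; apply: connect1.
  by rewrite /mono_rel qS' in_setD1 pw pS nbhd_sym.
have w_g z : z \in S' -> exists2 z', E z z' & col w z' = g.
  move=> zS'; move/existsPn/(_ z): allz; rewrite zS' /=.
  by case/forallPn => z'; rewrite negb_imply negbK => /andP[zz' /eqP]; exists z'.
have spread p q : p \in S' -> q \in S' -> col w p != g -> ~~ E p q ->
    col p q = col w p.
  move=> pS qS wp npq; have [q' qq' wq'] := w_g q qS.
  have q'S := mono_connect_in qq' qS.
  have npq' : ~~ E p q'.
    by apply: contra npq => pq'; apply: connect_trans pq' _; rewrite mono_connect_sym.
  have /andP[pq'_adj pq'g] := unconnected_adj cl' pS q'S npq'.
  rewrite -(unconnected_col cl' pS qS npq qq') col_sym.
  apply: (@gallai_third q' w p); rewrite ?(adj_sym q') ?wS' ?(col_sym q') ?wq' //.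
  by rewrite eq_sym.
have other x : x \in S' -> exists2 q, q \in S' & ~~ E x q.
  move=> xS; case: (boolP (E x x0)) => [xx0|nx]; last by exists x0.
  exists y1 => //; apply: contra n01 => xy1; apply: connect_trans xy1.
  by rewrite mono_connect_sym.
have [r [b [rb rg bg]]] : exists r b, [/\ r != b, r != g & b != g].
  have : 1 < #|~: [set g]| by rewrite cardsC1; lia.
  case/card_ge2_exists => r [b []]; rewrite !inE => rg bg rb.
  by exists r, b.
have [x xS wx] := all_w r; have [y yS wy] := all_w b.
case/negP: rb; apply/eqP.
have [xy|nxy] := boolP (E x y).
  have [q qS nxq] := other x xS.
  have nyq : ~~ E y q by apply: contra nxq; apply: connect_trans.
  rewrite -wx -wy -(spread x q) ?wx // -(spread y q) ?wy //.
  rewrite [RHS]col_sym [LHS]col_sym; apply: esym.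
  by apply: (unconnected_col cl' qS xS _ xy); rewrite mono_connect_sym.
rewrite -wx -wy -(spread x y) ?wx // -(spread y x) ?wy //; first exact: col_sym.
by rewrite /E mono_connect_sym.
Qed.

End GallaiStructure.

Lemma other_colors (g : 'I_3) : exists a b : 'I_3,
  [/\ a != g, b != g, a != b & forall d, d != g -> (d == a) || (d == b)].
Proof.
have /eqP/cards2P[a [b [ab gE]]] : #|~: [set g]| = 2 by rewrite cardsC1 card_ord.
have neq_g d : (d != g) = (d == a) || (d == b).
  by rewrite -(in_set2 d a b) -gE in_setC in_set1.
by exists a, b; split; rewrite ?neq_g ?eqxx ?orbT // => d; rewrite neq_g.
Qed.

(** * Colour degrees in a Gallai-coloured complete graph minus an edge *)

Section MissingEdge.

Variables (G : sgraph) (c : coloring G 'I_3) (u v : G) (m : nat).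
Hypothesis gallai_c : gallai c.
Hypothesis adjE : forall x y : G,
  adj x y = (x != y) && ([set x; y] != [set u; v]).
Hypothesis m6 : 6 <= m.
Hypothesis cardG : #|G| = 5 * m - 3.
Hypothesis deg_c : forall a x, #|nbhd c a x| < m.*2.

Local Notation col x y := (c [set x; y]).
Let S : {set G} := ~: [set u].

Let cardS : #|S| = 5 * m - 4.
Proof. by rewrite cardsC1 cardG; num_lia. Qed.

Let cliqueS : clique S.
Proof.
move=> x y; rewrite !inE => xu yu xy; rewrite adjE xy /=.
by apply/eqP => /setP/(_ u); rewrite !inE eqxx eq_sym (negPf xu) eq_sym (negPf yu).
Qed.

Let adj_u x : x \in S -> x != v -> adj u x.
Proof.
rewrite !inE => xu xv; rewrite adjE eq_sym xu /=.
by apply/eqP => /setP/(_ x); rewrite !inE eqxx orbT (negPf xu) (negPf xv).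
Qed.

Section Disconnected.

Variable g : 'I_3.

Local Notation E := (connect (mono_rel c g S)).

Definition mclass x : {set G} := [set y in S | E x y].

Definition across d x y := [&& x \in S, y \in S, ~~ E x y & col x y == d].

Lemma across_sym d : symmetric (across d).
Proof.
by move=> x y; rewrite /across (mono_connect_sym c) (col_sym c) andbCA.
Qed.

Lemma across_unconnected d x y : across d x y -> ~~ E x y.
Proof. by case/and4P. Qed.

(** This makes [across] a relation between components: by [across_sym] either end may be moved. *)
Lemma across_connect d x y z : across d x y -> E y z -> across d x z.
Proof.
case/and4P=> xS yS nxy /eqP xyd yz; have zS := mono_connect_in yz yS.
rewrite /across xS zS (unconnected_col gallai_c cliqueS xS yS nxy yz) -xyd eqxx.
rewrite andbT; apply: contra nxy => xz; apply: connect_trans xz _.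
by rewrite (mono_connect_sym c).
Qed.

Lemma across_colors a b x y : a != b -> across a x y -> ~~ across b x y.
Proof. by move=> ab /and4P[_ _ _ /eqP xya]; rewrite /across xya (negPf ab) !andbF. Qed.

Lemma in_mclass x y : (y \in mclass x) = (y \in S) && E x y.
Proof. by rewrite inE. Qed.

Lemma across_mclass d x y : across d x y -> mclass y \subset nbhd c d x.
Proof.
move=> xy; apply/subsetP => z; rewrite in_mclass => /andP[_ yz].
have /and4P[xS zS nxz /eqP xz] := across_connect xy yz.
rewrite in_nbhd xz eqxx andbT; apply: cliqueS => //.
by apply: contraNneq nxz => ->; apply: connect0.
Qed.

Lemma card_mclass2 x y :
  ~~ E x y -> #|mclass x :|: mclass y| = #|mclass x| + #|mclass y|.
Proof.
move=> nxy; apply/eqP; rewrite (leq_card_setU (mclass x) (mclass y)).2.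
apply/pred0P => z /=; apply: contraNF nxy; rewrite !in_mclass.
case/andP=> /andP[_ xz] /andP[_ yz]; apply: connect_trans xz _.
by rewrite (mono_connect_sym c).
Qed.

Lemma across_pair d x y z : across d x y -> across d x z -> ~~ E y z ->
  #|mclass y| + #|mclass z| < m.*2.
Proof.
move=> xy xz nyz; rewrite -card_mclass2 //; apply: leq_ltn_trans (deg_c d x).
by apply: subset_leq_card; rewrite subUset !across_mclass.
Qed.

(** The components of [y] and [z] already exhaust the [d]-degree allowed at [s], which leaves no
    room for [u]. *)
Lemma across_full d x y z s : across d x y -> across d x z -> ~~ E y z ->
    m.*2.-1 <= #|mclass y| + #|mclass z| -> s \in mclass x -> s != v ->
  col u s != d.
Proof.
move=> xy xz nyz full; rewrite in_mclass => /andP[sS xs] sv; apply/eqP => us.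
have sy : across d s y.
  by rewrite across_sym; apply: across_connect xs; rewrite across_sym.
have sz : across d s z.
  by rewrite across_sym; apply: across_connect xs; rewrite across_sym.
have : #|u |: (mclass y :|: mclass z)| <= #|nbhd c d s|.
  apply/subset_leq_card; rewrite !subUset !across_mclass // andbT sub1set.
  by rewrite nbhd_sym in_nbhd adj_u // -us eqxx.
rewrite cardsU1 card_mclass2 // !inE eqxx /= add1n => lt.
by have := deg_c d s; num_lia.
Qed.

(** In the triangle on [u], [s], [t] the edge [st] has colour [d] and [us] has colour [g], so [ut]
    has one of these, and [d] is excluded. *)
Lemma green_spread d x y s : d != g -> across d x y -> s \in mclass x -> s != v ->
    col u s = g -> (forall t, t \in mclass y -> t != v -> col u t != d) ->
  forall t, t \in mclass y -> t != v -> col u t = g.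
Proof.
move=> dg xy xs sv us full t yt tv; have utd := full t yt tv.
move: xs yt; rewrite !in_mclass => /andP[sS xs] /andP[tS yt].
have /and4P[_ _ nst /eqP std] : across d s t.
  apply: across_connect yt; rewrite across_sym.
  by apply: across_connect xs; rewrite across_sym.
have ts_adj : adj t s by apply: cliqueS => //; apply: contraNneq nst => ->; apply: connect0.
rewrite -us (col_sym c) [RHS](col_sym c).
apply: (gallai_third gallai_c ts_adj); rewrite ?(adj_sym _ u) ?adj_u //.
  by rewrite !(col_sym c _ s) std (col_sym c s) us.
by rewrite !(col_sym c t) std.
Qed.

Section TwoColors.

Variables a b : 'I_3.
Hypotheses (ag : a != g) (bg : b != g) (ab : a != b).
Hypothesis colors : forall d, d != g -> (d == a) || (d == b).

Lemma across_or x y : x \in S -> y \in S -> ~~ E x y -> across a x y || across b x y.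
Proof.
move=> xS yS nxy; rewrite /across xS yS nxy /=; apply: colors.
by have /andP[] := unconnected_adj cliqueS xS yS nxy.
Qed.

(** Outside the component every vertex is an [a]- or [b]-neighbour of [x]; these are at most
    [2 (2m-1)] of the [5m-4] vertices. *)
Lemma card_mclass x : x \in S -> m - 2 <= #|mclass x|.
Proof.
move=> xS; have : #|S| <= #|mclass x| + (#|nbhd c a x| + #|nbhd c b x|).
  apply: leq_trans (leq_add (leqnn _) (leq_cardsU _ _)).
  apply: leq_card_cover2; apply/subsetP => y yS; rewrite in_setU in_mclass yS /=.
  have [//|/(across_or xS yS)/orP[]] := boolP (E x y) => xy; rewrite in_setU.
    by rewrite (subsetP (across_mclass xy)) // in_mclass yS connect0.
  by rewrite (subsetP (across_mclass xy)) ?orbT // in_mclass yS connect0.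
by have := deg_c a x; have := deg_c b x; num_lia.
Qed.

(** Three such components would give at least [3 (m-2)] neighbours in colour [d], which is at least
    [2m] because [6 <= m]. *)
Lemma across_three d x y1 y2 y3 : across d x y1 -> across d x y2 -> across d x y3 ->
  ~~ E y1 y2 -> ~~ E y1 y3 -> ~~ E y2 y3 -> False.
Proof.
move=> xy1 xy2 xy3 n12 n13 n23.
have : #|mclass y1 :|: mclass y2 :|: mclass y3| <= #|nbhd c d x|.
  by apply: subset_leq_card; rewrite !subUset !across_mclass.
have /eqP -> : #|mclass y1 :|: mclass y2 :|: mclass y3| ==
    #|mclass y1 :|: mclass y2| + #|mclass y3|.
  rewrite (leq_card_setU _ _).2; apply/pred0P => z /=; apply/negP.
  rewrite in_setU !in_mclass => /andP[/orP[]/andP[_ y1z] /andP[_ y3z]].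
    case/negP: n13; apply: connect_trans y1z _; by rewrite (mono_connect_sym c).
  case/negP: n23; apply: connect_trans y1z _; by rewrite (mono_connect_sym c).
rewrite card_mclass2 //.
have [/and4P[_ y1S _ _] /and4P[_ y2S _ _]] := (xy1, xy2).
have /and4P[_ y3S _ _] := xy3.
have := card_mclass y1S; have := card_mclass y2S; have := card_mclass y3S.
by have := deg_c d x; num_lia.
Qed.

(** Two neighbourhoods of colour [d] cover at most [4m-2] of the [5m-4] vertices. *)
Lemma across_nondominating d x y : exists2 z, z \in S & ~~ across d x z && ~~ across d y z.
Proof.
have : ~~ (S \subset nbhd c d x :|: nbhd c d y).
  apply: contraTN (deg_c d x) => /leq_card_cover2; rewrite cardS -leqNgt.
  by have := deg_c d y; num_lia.
case/subsetPn => z zS; rewrite in_setU negb_or => /andP[nx ny]; exists z => //.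
have zz : z \in mclass z by rewrite in_mclass zS connect0.
apply/andP; split.
  by apply: contra nx => /across_mclass/subsetP/(_ z zz).
by apply: contra ny => /across_mclass/subsetP/(_ z zz).
Qed.

End TwoColors.

(** The two-coloured [K_5] without monochromatic triangle: a 5-cycle in [a] and the complementary
    5-cycle in [b]. *)
Definition pentagon a b x1 x2 x3 x4 x5 :=
  [&& across a x1 x2, across a x2 x3, across a x3 x4, across a x4 x5 & across a x5 x1] &&
  [&& across b x1 x3, across b x2 x4, across b x3 x5, across b x4 x1 & across b x5 x2].

Lemma pentagon_rot a b x1 x2 x3 x4 x5 :
  pentagon a b x1 x2 x3 x4 x5 -> pentagon a b x2 x3 x4 x5 x1.
Proof.
case/andP=> /and5P[r12 r23 r34 r45 r51] /and5P[r13 r24 r35 r41 r52].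
by apply/andP; split; apply/and5P; split.
Qed.

Section Pentagon.

Variables a b : 'I_3.
Hypotheses (ag : a != g) (bg : b != g) (ab : a != b).
Hypothesis colors : forall d, d != g -> (d == a) || (d == b).

(** By [across_nondominating] there are [z] joined in [b] to [x] and [y], [w] joined in [a] to [x]
    and [z], and [t] joined in [a] to [y] and [z]. The remaining pairs have colour [b], since
    [across_three] forbids a third [a]-neighbour. *)
Lemma pentagon_exists x y : across a x y ->
  exists x3 x4 x5, pentagon a b x y x3 x4 x5.
Proof.
have or2 := across_or colors; have three := across_three colors.
have nondom := across_nondominating.
have sym p q : E p q = E q p by rewrite (mono_connect_sym c).
move=> xy; have /and4P[xS yS nxy _] := xy.
have yx : across a y x by rewrite across_sym.
have far d p q z : across d p q -> ~~ across d p z -> ~~ E q z.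
  by move=> pq; apply: contra; apply: across_connect.
have [z zS /andP[xz yz]] := nondom a x y.
have nyz := far _ _ _ _ xy xz; have nxz := far _ _ _ _ yx yz.
have {}xz : across b x z by have := or2 _ _ xS zS nxz; rewrite (negPf xz).
have {}yz : across b y z by have := or2 _ _ yS zS nyz; rewrite (negPf yz).
have zx : across b z x by rewrite across_sym.
have zy : across b z y by rewrite across_sym.
have [w wS /andP[xw zw]] := nondom b x z.
have nzw := far _ _ _ _ xz xw; have nxw := far _ _ _ _ zx zw.
have nyw := far _ _ _ _ zy zw.
have {}xw : across a x w by have := or2 _ _ xS wS nxw; rewrite (negPf xw) orbF.
have {}zw : across a z w by have := or2 _ _ zS wS nzw; rewrite (negPf zw) orbF.
have [t tS /andP[yt zt]] := nondom b y z.
have nzt := far _ _ _ _ yz yt; have nyt := far _ _ _ _ zy zt.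
have nxt := far _ _ _ _ zx zt.
have {}yt : across a y t by have := or2 _ _ yS tS nyt; rewrite (negPf yt) orbF.
have {}zt : across a z t by have := or2 _ _ zS tS nzt; rewrite (negPf zt) orbF.
have yw : across b y w.
  case/orP: (or2 _ _ yS wS nyw) => // yw.
  by case: (three a w x y z); rewrite // across_sym.
have nwt : ~~ E w t.
  apply/negP => wt; have /negP[] := across_colors ab yt.
  exact: across_connect wt.
have xt : across b x t.
  case/orP: (or2 _ _ xS tS nxt) => // xt.
  by case: (three a t x y z); rewrite // across_sym.
have wt : across b w t.
  case/orP: (or2 _ _ wS tS nwt) => // wt.
  case: (three a w x z t) => //; by rewrite across_sym.
exists t, z, w; apply/andP; split; apply/and5P; split => //; by rewrite across_sym.
Qed.

(** Already [x1] has two neighbouring components in each colour; a sixth component would be a third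
    one. *)
Lemma pentagon_cover x1 x2 x3 x4 x5 s : pentagon a b x1 x2 x3 x4 x5 -> s \in S ->
  [|| s \in mclass x1, s \in mclass x2, s \in mclass x3, s \in mclass x4
    | s \in mclass x5].
Proof.
have or2 := across_or colors; have three := across_three colors.
case/andP=> /and5P[r12 r23 r34 r45 r51] /and5P[r13 r24 r35 r41 r52] sS.
apply: contraT; rewrite !in_mclass sS !negb_or /= => /and5P[n1 n2 n3 n4 n5].
have x1S : x1 \in S by case/and4P: r12.
rewrite across_sym in r51; rewrite across_sym in r41.
case/orP: (or2 _ _ x1S sS n1) => r1.
  by case: (three a x1 x2 x5 s) => //; apply: (@across_unconnected b); rewrite across_sym.
by case: (three b x1 x3 x4 s) => //; apply: (@across_unconnected a).
Qed.

Lemma pentagon_card x1 x2 x3 x4 x5 : pentagon a b x1 x2 x3 x4 x5 ->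
  5 * m - 4 <= #|mclass x1| + #|mclass x2| + #|mclass x3| + #|mclass x4| + #|mclass x5|.
Proof.
move=> pent; rewrite -cardS.
have /subset_leq_card/leq_trans -> // : S \subset
    mclass x1 :|: mclass x2 :|: mclass x3 :|: mclass x4 :|: mclass x5.
  apply/subsetP => s /(pentagon_cover pent); rewrite !in_setU.
  by case/or4P => [->|->|->|/orP[]->]; rewrite ?orbT.
by do 4!apply: leq_trans (leq_cardsU _ _) (leq_add _ (leqnn _)).
Qed.

(* Any two vertices of the pentagon have a common neighbour in one of the two
   colours. *)
Lemma pentagon_pair x1 x2 x3 x4 x5 : pentagon a b x1 x2 x3 x4 x5 ->
  [/\ #|mclass x1| + #|mclass x2| < m.*2, #|mclass x1| + #|mclass x3| < m.*2,
      #|mclass x1| + #|mclass x4| < m.*2 & #|mclass x1| + #|mclass x5| < m.*2].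
Proof.
case/andP=> /and5P[r12 r23 r34 r45 r51] /and5P[r13 r24 r35 r41 r52].
have [n12 n13] := (across_unconnected r12, across_unconnected r13).
have n14 : ~~ E x1 x4 by apply: (@across_unconnected b); rewrite across_sym.
have n15 : ~~ E x1 x5 by apply: (@across_unconnected a); rewrite across_sym.
split.
- by apply: (@across_pair b x4) => //; rewrite across_sym.
- by apply: (@across_pair a x2) => //; rewrite across_sym.
- by apply: (@across_pair a x5) => //; rewrite across_sym.
- by apply: (@across_pair b x3) => //; rewrite across_sym.
Qed.

(** The bounds on pairs and on the total force order [m] for part 1 and [m-1] for the others. Then
    parts 2 and 5 are saturated in [a], parts 3 and 4 in [b]. *)
Lemma pentagon_large x1 x2 x3 x4 x5 : pentagon a b x1 x2 x3 x4 x5 ->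
  m <= #|mclass x1| -> False.
Proof.
move=> pent K1; have [p2 p3 p4 p5] := pentagon_pair pent.
have := pentagon_card pent => K.
have [k2 k3 k4 k5] : [/\ m.-1 <= #|mclass x2|, m.-1 <= #|mclass x3|,
   m.-1 <= #|mclass x4| & m.-1 <= #|mclass x5|] by split; num_lia.
case/andP: (pent) => /and5P[r12 r23 r34 r45 r51] /and5P[r13 r24 r35 r41 r52].
have [n12 n13] := (across_unconnected r12, across_unconnected r13).
have n14 : ~~ E x1 x4 by apply: (@across_unconnected b); rewrite across_sym.
have n15 : ~~ E x1 x5 by apply: (@across_unconnected a); rewrite across_sym.
have sw d x y : across d x y -> across d y x by rewrite across_sym.
have full2 s : s \in mclass x2 -> s != v -> col u s != a.
  by apply: (across_full (sw _ _ _ r12) r23 n13); num_lia.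
have full5 s : s \in mclass x5 -> s != v -> col u s != a.
  by apply: (across_full r51 (sw _ _ _ r45) n14); num_lia.
have full3 s : s \in mclass x3 -> s != v -> col u s != b.
  by apply: (across_full (sw _ _ _ r13) r35 n15); num_lia.
have full4 s : s \in mclass x4 -> s != v -> col u s != b.
  by apply: (across_full r41 (sw _ _ _ r24) n12); num_lia.
pose green x := exists s, [/\ s \in mclass x, s != v & col u s = g].
pose all_green x := forall s, s \in mclass x -> s != v -> col u s = g.
have all_ex x : m.-1 <= #|mclass x| -> all_green x -> green x.
  move=> kx gx; have /card_gt0P[s] : 0 < #|mclass x :\ v|.
    by have := leq_cardD (mclass x) (eq_leq (cards1 v)); num_lia.
  by rewrite in_setD1 => /andP[sv sx]; exists s; split=> //; apply: gx.
have spread d x y : d != g -> across d x y -> (forall t, t \in mclass y -> t != v -> col u t != d) ->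
    green x -> all_green y.
  by move=> dg xy full [s [sx sv us]]; apply: green_spread full; eassumption.
(* Colour [g] at [u] passes from part 1 to part 2 and round the cycle 2, 4, 5, 3, 2, each time
   entering a part across the colour saturated there. *)
have s12 : green x1 -> all_green x2 by apply: (spread a).
have s24 : green x2 -> all_green x4 by apply: (spread b).
have s45 : green x4 -> all_green x5 by apply: (spread a).
have s53 : green x5 -> all_green x3 by apply: (spread b) => //; apply: sw.
have s32 : green x3 -> all_green x2 by apply: (spread a) => //; apply: sw.
have [/existsP[s /and3P[sS sv /eqP us]]|/existsPn no_green] :=
    boolP [exists s, [&& s \in S, s != v & col u s == g]].
  have g2 : all_green x2.
    have gr x : s \in mclass x -> green x by exists s.
    have /or4P[/gr|/gr|/gr|/orP[]/gr] := pentagon_cover pent sS.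
    - exact: s12.
    - by move=> /s24/(all_ex _ k4)/s45/(all_ex _ k5)/s53/(all_ex _ k3)/s32.
    - exact: s32.
    - by move=> /s45/(all_ex _ k5)/s53/(all_ex _ k3)/s32.
    - by move=> /s53/(all_ex _ k3)/s32.
  have g4 := s24 (all_ex _ k2 g2); have g5 := s45 (all_ex _ k4 g4).
  have g3 := s53 (all_ex _ k5 g5).
  have : #|S :\: (v |: mclass x1)| <= #|nbhd c g u|.
    apply/subset_leq_card/subsetP => t; rewrite in_setD in_setU1 negb_or.
    case/andP=> /andP[tv t1] tS; rewrite in_nbhd adj_u //=; apply/eqP.
    have := pentagon_cover pent tS; rewrite (negPf t1) /=.
    by case/or4P => tx; [exact: g2|exact: g3|exact: g4|exact: g5].
  have := leq_cardD S (leq_cardsU [set v] (mclass x1)).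
  by rewrite cards1 cardS; have := deg_c g u; num_lia.
(* Without colour [g], at least [5m-5] edges at [u] would share two colours, each used fewer than
   [2m] times. *)
have : #|S :\ v| <= #|nbhd c a u| + #|nbhd c b u|.
  apply: leq_card_cover2; apply/subsetP => s; rewrite in_setD1 => /andP[sv sS].
  have := no_green s; rewrite sS sv /= => /colors us.
  by rewrite in_setU !in_nbhd !adj_u.
have := leq_cardD S (eq_leq (cards1 v)); rewrite cardS.
by have := deg_c a u; have := deg_c b u; num_lia.
Qed.

End Pentagon.

End Disconnected.

Lemma missing_edge_degree : False.
Proof.
have [|||g [x [y [xS yS nxy]]]] := gallai_disconnected (S := S) gallai_c.
- by rewrite card_ord.
- exact: cliqueS.
- by rewrite cardS; num_lia.
have [a [b [ag bg ab colors]]] := other_colors g.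
(* Five parts of order below [m] cannot hold [5m-4] vertices, so some rotation starts with a part of
   order at least [m]. *)
have large a' b' z1 z2 z3 z4 z5 : a' != b' -> a' != g -> b' != g ->
    (forall d, d != g -> (d == a') || (d == b')) -> ~~ pentagon g a' b' z1 z2 z3 z4 z5.
  move=> ab' ag' bg' colors'; apply/negP => pent.
  have small := @pentagon_large g a' b' ag' bg' colors'.
  have pent2 := pentagon_rot pent; have pent3 := pentagon_rot pent2.
  have pent4 := pentagon_rot pent3; have pent5 := pentagon_rot pent4.
  have lt t1 t2 t3 t4 t5 : pentagon g a' b' t1 t2 t3 t4 t5 -> #|mclass g t1| < m.
    by move=> p; rewrite ltnNge; apply/negP; apply: small p.
  have := pentagon_card colors' pent; have := lt _ _ _ _ _ pent.
  have := lt _ _ _ _ _ pent2; have := lt _ _ _ _ _ pent3.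
  have := lt _ _ _ _ _ pent4; have := lt _ _ _ _ _ pent5.
  by num_lia.
case/orP: (across_or colors xS yS nxy) => xy.
  have [z3 [z4 [z5 pent]]] := pentagon_exists ab colors xy.
  by have := large a b x y z3 z4 z5 ab ag bg colors; rewrite pent.
have colorsC d : d != g -> (d == b) || (d == a) by move/colors; rewrite orbC.
have ba : b != a by rewrite eq_sym.
have [z3 [z4 [z5 pent]]] := pentagon_exists ba colorsC xy.
by have := large b a x y z3 z4 z5 ba bg ag colorsC; rewrite pent.
Qed.

End MissingEdge.

(** * From stars to subdivided stars *)

Lemma missing_edge_star_plus (G : sgraph) (c : coloring G 'I_3) (u v : G) m :
    gallai c -> (forall x y : G, adj x y = (x != y) && ([set x; y] != [set u; v])) ->
    6 <= m -> #|G| = 5 * m - 3 ->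
  exists a, has_copy c a (star_plus m.*2).
Proof.
move=> gallai_c adjE m6 cardG; apply/existsP/contraT => /existsPn no_copy.
have [g [v0 deg]] : exists g v0, m.*2 <= #|nbhd c g v0|.
  have [/existsP[g /existsP[v0 deg]]|no] :=
    boolP [exists g, [exists v0, m.*2 <= #|nbhd c g v0|]]; first by exists g, v0.
  case: (@missing_edge_degree G c u v m) => // a x; rewrite ltnNge.
  by apply: contra no => deg; apply/existsP; exists a; apply/existsP; exists x.
have [a [b [ag bg ab colors]]] := other_colors g.
have m2 : 0 < m.*2 by num_lia.
set D := nbhd c g v0 in deg *; pose W := ~: (v0 |: D).
have v0D : v0 \notin D by rewrite nbhd_irr.
have inW w : w \in W -> (w != v0) && (w \notin D).
  by rewrite in_setC in_setU1 negb_or.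
have DW x w : x \in D -> w \in W -> c [set x; w] != g \/ ~~ adj x w.
  move=> xD /inW/andP[wv wD]; case: (boolP (adj x w)) => [xw|]; last by right.
  left; apply: contra (no_copy g) => xwg.
  apply: (@copy_star_plus _ _ c g _ v0 x w) => //; first by rewrite in_nbhd xw.
  have -> : D :\: [set x; w] = D :\ x.
    apply/setP => y; rewrite in_setD in_set2 in_setD1 negb_or -andbA.
    by case: (eqVneq y w) => // ->; rewrite (negPf wD) !andbF.
  by have := cardsD1 x D; rewrite xD add1n; num_lia.
have Wv0 w : w \in W -> adj v0 w -> c [set v0; w] != g.
  by case/inW/andP=> _ wD v0w; move: wD; rewrite in_nbhd v0w.
have cardW : #|W| = 5 * m - 4 - #|D|.
  by have := cardsC (v0 |: D); rewrite cardsU1 v0D cardG -/W; num_lia.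
(* If [W] has at most two vertices, [D] is so large that a [g]-edge inside it would give a copy;
   then [D :\ u] is a two-coloured complete graph of order at least [5m-7 >= 4m-1]. *)
have [W3|W2] := leqP 3 #|W|; last first.
  have DD : {in D &, forall x y, y \notin nbhd c g x}.
    move=> x y xD yD; apply: contra (no_copy g) => xy.
    apply: (@copy_star_plus _ _ c g _ v0 x y) => //.
      by apply: contraNneq v0D => <-.
    by apply: leq_trans (leq_cardD D (leq_cards2 x y)); num_lia.
  have /orP[] : has_copy c a (star_plus m.*2) || has_copy c b (star_plus m.*2); last 2 first.
  - by rewrite (negPf (no_copy a)).
  - by rewrite (negPf (no_copy b)).
  apply: (@two_colored_clique_star_plus G _ c a b m.*2 (D :\ u)) => //.
  - num_lia.
  - by rewrite odd_double.
  - by apply: leq_trans (leq_cardD D (eq_leq (cards1 u))); num_lia.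
  move=> x y; rewrite !in_setD1 => /andP[xu xD] /andP[yu yD] xy.
  have xy_adj : adj x y.
    rewrite adjE xy /=; apply/eqP => /setP/(_ u).
    by rewrite !inE eqxx eq_sym (negPf xu) eq_sym (negPf yu).
  by have := DD x y xD yD; rewrite !in_nbhd xy_adj => /colors.
(* At most one vertex of [W] can miss a neighbour in [v0 |: D], and it is an end of the deleted
   edge. *)
have [z zP] : exists z, forall w x, w \in W -> w != z -> x \in v0 |: D -> adj w x.
  exists (if u \in W then u else v) => w x wW wz xD.
  have xW : x \notin W by rewrite in_setC xD.
  rewrite adjE; apply/andP; split; first by apply: contraNneq xW => <-.
  apply/eqP => E; have : w \in [set u; v] by rewrite -E set21.
  have : x \in [set u; v] by rewrite -E set22.
  move: wz; case: ifP => [uW wu|uW wv].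
    rewrite !in_set2 (negPf wu) /= => xuv /eqP wv.
    case/orP: xuv => /eqP xu; first by rewrite xu uW in xW.
    by move: E; rewrite xu wv => /setP/(_ u); rewrite !inE eqxx -wv eq_sym (negPf wu).
  by rewrite !in_set2 (negPf wv) orbF => _ /eqP wu; rewrite -wu wW in uW.
have /card_ge2_exists[w1 [w2 [w1W w2W w12]]] : 1 < #|W :\ z|.
  by apply: leq_trans (leq_cardD W (eq_leq (cards1 z))); num_lia.
move: w1W w2W; rewrite !in_setD1 => /andP[w1z w1W] /andP[w2z w2W].
have /card_gt0P[w3] : 0 < #|W :\: [set w1; w2]|.
  by apply: leq_trans (leq_cardD W (leq_cards2 w1 w2)); num_lia.
rewrite in_setD in_set2 negb_or => /andP[/andP[w31 w32] w3W].
(* The edge from [v0] to [x] has colour [g] and the other two sides of the triangle do not, so these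
   agree. *)
have uniform w x : w \in W -> w != z -> x \in D -> c [set x; w] = c [set v0; w].
  move=> wW wz xD; have wv0 : adj w v0 by apply: (zP w) => //; apply: setU11.
  have wx : adj w x by apply: (zP w) => //; apply: setU1r.
  have := xD; rewrite in_nbhd => /andP[v0x /eqP v0xg].
  apply: (gallai_third gallai_c (y := v0)); rewrite 1?adj_sym //.
    by rewrite (col_sym c x) v0xg eq_sym Wv0 // adj_sym.
  rewrite (col_sym c x v0) v0xg; case: (DW x w xD wW) => //.
  by rewrite adj_sym wx.
(* By uniformity [w] sees [v0 |: D] in one colour; an edge of that colour from [D] to another [w']
   would complete a subdivided star. *)
have other w w' x : w \in W -> w != z -> w' \in W -> w' != w -> x \in D ->
    adj x w' -> c [set x; w'] != c [set v0; w].
  move=> wW wz w'W w'w xD xw'; apply: contra (no_copy (c [set v0; w])) => col_xw'.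
  have sub : v0 |: D \subset nbhd c (c [set v0; w]) w.
    apply/subsetP => y yD; rewrite in_nbhd (zP w) //= (col_sym c w).
    by case/setU1P: yD => [->|yD] //; rewrite uniform.
  apply: (@copy_star_plus _ _ c _ _ w x w') => //.
  - by apply: (subsetP sub); apply: setU1r.
  - by rewrite in_nbhd xw'.
  have sub' : D :\ x \subset nbhd c (c [set v0; w]) w :\: [set x; w'].
    apply/subsetP => y; rewrite in_setD1 in_setD in_set2 negb_or => /andP[yx yD].
    rewrite yx (subsetP sub) ?setU1r // andbT /=.
    by apply: contraTneq yD => ->; case/inW/andP: w'W.
  apply: leq_trans (subset_leq_card sub').
  by have := cardsD1 x D; rewrite xD add1n; num_lia.
(* Since [w3] may be [z], [x] is taken off the deleted edge. The edges [v0 w1], [v0 w2] and [x w3]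
   get three different colours other than [g], but only two exist. *)
have /card_gt0P[x] : 0 < #|D :\: [set u; v]|.
  by apply: leq_trans (leq_cardD D (leq_cards2 u v)); num_lia.
rewrite in_setD => /andP[xuv xD].
have xw3 : adj x w3.
  rewrite adjE; apply/andP; split; first by apply: contraTneq xD => ->; case/inW/andP: w3W.
  by apply: contraNneq xuv => <-; apply: set21.
have w1x : adj w1 x by apply: zP => //; apply: setU1r.
have w2x : adj w2 x by apply: zP => //; apply: setU1r.
have w1v : adj w1 v0 by apply: zP => //; apply: setU11.
have w2v : adj w2 v0 by apply: zP => //; apply: setU11.
have e1 : c [set x; w3] != c [set v0; w1] by apply: other.
have e2 : c [set x; w3] != c [set v0; w2] by apply: other.
have e3 : c [set v0; w2] != c [set v0; w1].
  by rewrite -(uniform w2 x) //; apply: other; rewrite // 1?eq_sym // adj_sym.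
have f1 : c [set v0; w1] != g by rewrite Wv0 // adj_sym.
have f2 : c [set v0; w2] != g by rewrite Wv0 // adj_sym.
have f3 : c [set x; w3] != g by case: (DW x w3 xD w3W) => //; rewrite xw3.
move: e1 e2 e3; case/orP: (colors _ f1) => /eqP->; case/orP: (colors _ f2) => /eqP->;
  by case/orP: (colors _ f3) => /eqP->; rewrite ?eqxx.
Qed.

(** * Transport of colourings and criteria for fullness *)

(** Serves both to restrict a colouring to a smaller graph and to rename vertices; composition with
    [h] sends copies to copies. *)
Lemma coloring_pullback (G G' : sgraph) (C : finType) (h : G -> G')
    (c' : coloring G' C) :
    injective h -> {homo h : x y / adj x y} ->
  exists c : coloring G C, (forall a H, has_copy c a H -> has_copy c' a H) /\
    (gallai c' -> gallai c).
Proof.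
move=> h_inj h_adj; pose c : coloring G C := [ffun A : {set G} => c' (h @: A)].
have cE x y : c [set x; y] = c' [set h x; h y] by rewrite ffunE imsetU1 imset_set1.
exists c; split=> [a H /has_copyP[f f_inj f_adj]|gallai_c'].
  apply/has_copyP; exists (h \o f) => [|x y /f_adj]; first exact: inj_comp.
  by rewrite !in_nbhd cE => /andP[/h_adj -> ->].
apply/forallP => x; apply/forallP => y; apply/forallP => z; apply/implyP.
case/and3P=> /h_adj xy /h_adj yz /h_adj xz; rewrite !cE.
move/forallP/(_ (h x))/forallP/(_ (h y))/forallP/(_ (h z)): gallai_c'.
by rewrite xy yz xz.
Qed.

Lemma set2_eqP (T : finType) (x y z t : T) :
  [set x; y] = [set z; t] -> x = z /\ y = t \/ x = t /\ y = z.
Proof.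
move=> E; have xzt : x \in [set z; t] by rewrite -E set21.
have yzt : y \in [set z; t] by rewrite -E set22.
have zxy : z \in [set x; y] by rewrite E set21.
have txy : t \in [set x; y] by rewrite E set22.
case/set2P: xzt => xE; case/set2P: yzt => yE; subst; auto.
  by move: txy; rewrite !inE orbb => /eqP->; left.
by move: zxy; rewrite !inE orbb => /eqP->; left.
Qed.

(** The colour of a set is read off any pair spanning it, which is harmless as [f] is symmetric;
    [a0] fills the sets spanned by no pair. *)
Lemma coloring_of (G : sgraph) (C : finType) (a0 : C) (f : G -> G -> C) :
    (forall x y, f x y = f y x) ->
  exists c : coloring G C, forall x y, c [set x; y] = f x y.
Proof.
move=> f_sym; exists [ffun A : {set G} =>
  if [pick p : G * G | A == [set p.1; p.2]] is Some p then f p.1 p.2 else a0].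
move=> x y; rewrite ffunE; case: pickP => [[z t] /eqP /= /set2_eqP[[-> ->]|[-> ->]] //|].
by move/(_ (x, y)); rewrite eqxx.
Qed.

Section CompleteOn.

Variable T : finType.

Lemma complete_on_sym : symmetric (fun x y : T => x != y).
Proof. by move=> x y; rewrite eq_sym. Qed.

Lemma complete_on_irr : irreflexive (fun x y : T => x != y).
Proof. by move=> x; rewrite eqxx. Qed.

(** Lets the extremal colourings be built on sum and product types and carried to ordinals
    afterwards. *)
Definition complete_on : sgraph := SGraph complete_on_sym complete_on_irr.

End CompleteOn.

Lemma complete_adjE N (u v x y : complete N) :
  @adj (delete_edge u v) x y = (x != y) && ([set x; y] != [set u; v]).
Proof. by []. Qed.

(** Every smaller complete graph embeds in [K_N - uv] away from [u], so [c] also gives the lower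
    bound on the Ramsey number. *)
Lemma ramsey_fullI (H : sgraph) N (u v : complete N)
    (c : coloring (delete_edge u v) bool) :
    adj u v -> (forall a, ~~ has_copy c a H) ->
    (forall c' : coloring (complete N) bool, has_mono_copy c' H) ->
  ramsey_full H.
Proof.
move=> uv no_copy all_copy.
have EN : ramsey_number H = N.
  rewrite /ramsey_number; case: ex_minnP => M /andP[M0 /forallP allM] minM.
  have N0 : 0 < N by apply: leq_ltn_trans (ltn_ord u).
  have leMN : M <= N by apply: minM; rewrite N0; apply/forallP.
  apply/eqP; rewrite eqn_leq leMN leqNgt; apply/negP => ltMN.
  case: N u v c uv no_copy all_copy ltMN {N0 leMN minM}=> // N u v c _ no_copy _ ltMN.
  pose h (i : complete M) : delete_edge u v := lift u (widen_ord (ltMN : M <= N) i).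
  have h_inj : injective h by move=> i j /lift_inj/(congr1 val)/= /val_inj.
  have [||c' [c'c _]] := @coloring_pullback (complete M) _ bool h c.
  - exact: h_inj.
  - move=> i j ij; rewrite complete_adjE (inj_eq h_inj); apply/andP; split=> //.
    apply/eqP => /setP/(_ u).
    by rewrite !in_set2 eqxx !(negPf (neq_lift _ _)).
  have /existsP[a /c'c] := allM c'.
  by rewrite (negPf (no_copy a)).
by rewrite /ramsey_full EN; exists u, v; split=> //; exists c.
Qed.

(** The last hypothesis serves twice: with [u = v] it bounds the Gallai-Ramsey number from above,
    with [u] and [v] adjacent it refutes fullness. *)
Lemma not_gallai_ramsey_full_at k (H : sgraph) N (c : coloring (complete N.-1) 'I_k) :
    1 < N -> gallai c -> ~~ has_mono_copy c H ->
    (forall (u v : complete N) (c' : coloring (delete_edge u v) 'I_k),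
       gallai c' -> has_mono_copy c' H) ->
  ~ gallai_ramsey_full_at k H.
Proof.
move=> N1 gallai_c no_copy all_copy.
have EN : gallai_ramsey_number k H = N.
  rewrite /gallai_ramsey_number; case: ex_minnP => M /andP[M0 /forallP allM] minM.
  have leMN : M <= N.
    apply: minM; rewrite (ltnW N1); apply/forallP => c'; apply/implyP => gallai_c'.
    (* Deleting the degenerate pair [u], [u] removes no edge, so [K_N] itself is covered. *)
    pose u : complete N := Ordinal N1.
    have [||c'' [c''c' gallai_c'']] := @coloring_pullback (delete_edge u u) (complete N) _ id c'.
    - by [].
    - by move=> x y /andP[xy _]; apply: xy.
    have /existsP[a /c''c' aP] := all_copy _ _ c'' (gallai_c'' gallai_c').
    by apply/existsP; exists a.
  apply/eqP; rewrite eqn_leq leMN leqNgt; apply/negP => ltMN.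
  have leM : M <= N.-1 by lia.
  have [||c' [c'c gallai_c']] :=
      @coloring_pullback (complete M) _ _ (widen_ord leM : _ -> complete N.-1) c.
  - by move=> i j /(congr1 val)/= /val_inj.
  - by [].
  have /implyP/(_ (gallai_c' gallai_c))/existsP[a /c'c aP] := allM c'.
  by case/negP: no_copy; apply/existsP; exists a.
rewrite /gallai_ramsey_full_at EN => -[u [v [_ [c' [gallai_c' /negP]]]]]; apply.
exact: all_copy.
Qed.

(** * Extremal colourings *)

Lemma card_sum_set (T1 T2 : finType) (A : {set T1 + T2}) :
  #|A| = #|[set i | inl i \in A]| + #|[set j | inr j \in A]|.
Proof.
rewrite -!sum1dep_card -sum1_card big_mkcond big_sumType /=.
by rewrite -!big_mkcond.
Qed.

(* Two red cliques of orders [n] and [n.-1] joined in blue; a perfect matching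
   of the first one is made blue and a maximum matching across is made red.  The
   only unmatched vertex has blue degree [n], and the deleted edge is the blue
   one joining it to its partner in the first clique. *)
Lemma ramsey_coloring n : 12 <= n -> ~~ odd n ->
  exists (u v : complete n.*2.-1) (c : coloring (delete_edge u v) bool),
    adj u v /\ forall a, ~~ has_copy c a (star n).
Proof.
move=> n12 nev; pose T : finType := ('I_n + 'I_n.-1)%type.
(* Red is [true]. Halving pairs the indices [2k] and [2k+1] in the first clique; across, equal
   indices are matched. *)
pose f (x y : T) := match x, y with
  | inl i, inl j => i./2 != j./2
  | inr _, inr _ => true
  | inl i, inr j | inr j, inl i => i == j :> nat
  end.
have ltu : n.-1 < n by lia.
have ltv : n.-2 < n by lia.
pose u : complete_on T := inl (Ordinal ltu); pose v : complete_on T := inl (Ordinal ltv).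
have uv : u != v by apply/eqP => -[]; lia.
have [|c cE] := @coloring_of (delete_edge u v) _ true f.
  by move=> [i|i] [j|j] //=; rewrite eq_sym.
have cardT : #|T| = n.*2.-1 by rewrite card_sum !card_ord; lia.
pose N a (x y : T) := (x != y) && ([set x; y] != [set u; v]) && (f x y == a).
have cardN a (x : T) :
    #|nbhd c a x| = #|[set i | N a x (inl i)]| + #|[set j | N a x (inr j)]|.
  have -> : nbhd c a x = [set y | N a x y].
    by apply/setP => y; rewrite in_nbhd cE in_set.
  by rewrite (card_sum_set [set y : T | N a x y]); congr (_ + _);
    apply: eq_card => i; rewrite !in_set.
have deg a x : #|nbhd c a x| < n.
  rewrite cardN; case: x => [i|j].
    have lti' : (if odd i then i.-1 else i.+1) < n.
      by have := ltn_ord i; case: ifP; lia.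
    pose i' := Ordinal lti'.
    have half_eq (j : 'I_n) : (i./2 == j./2) = (j \in [set i; i']).
      by rewrite !inE -!val_eqE /=; case: ifP; lia.
    have ii' : i != i' by rewrite -val_eqE /=; case: ifP; lia.
    case: a.
      have A1 : #|[set j | N true (inl i) (inl j)]| <= n - 2.
        have -> : n - 2 = #|~: [set i; i']|.
          by rewrite cardsCs setCK cards2 ii' card_ord.
        apply/subset_leq_card/subsetP => j; rewrite inE /N /= in_setC eqb_id.
        by case/andP=> _; rewrite half_eq.
      have A2 : #|[set j | N true (inl i) (inr j)]| <= 1.
        apply/card_le1_eqP => j j'; rewrite !inE /N /= !eqb_id.
        by case/andP=> _ /eqP E1 /andP[_ /eqP E2]; apply/val_inj; rewrite /= -E1 -E2.
      by num_lia.
    have [ilt|ige] := ltnP i n.-1.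
      have A1 : #|[set j | N false (inl i) (inl j)]| <= 1.
        rewrite -(cards1 i'); apply/subset_leq_card/subsetP => j.
        rewrite inE /N /= eqbF_neg negbK half_eq => /andP[/andP[ij _]].
        by rewrite in_set2 in_set1 => /orP[/eqP ji|//]; rewrite ji eqxx in ij.
      have A2 : #|[set j | N false (inl i) (inr j)]| <= n.-2.
        have -> : n.-2 = #|~: [set Ordinal ilt]| by rewrite cardsC1 card_ord.
        apply/subset_leq_card/subsetP => j; rewrite inE /N /= eqbF_neg.
        by case/andP=> _ ij; rewrite in_setC in_set1 -val_eqE /= eq_sym.
      by num_lia.
    (* Here [i] is [n.-1], so the vertex is [u], whose edge to its blue partner is the deleted
       one. *)
    have A1 : #|[set j | N false (inl i) (inl j)]| <= 0.
      rewrite leqn0 cards_eq0; apply/eqP/setP => j; rewrite inE /N /= in_set0.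
      rewrite eqbF_neg negbK half_eq; apply/negP => /andP[/andP[ij Ne]].
      rewrite in_set2 => /orP[/eqP ji|/eqP ji']; first by rewrite ji eqxx in ij.
      case/eqP: Ne; congr [set inl _; inl _]; apply/val_inj => /=.
        by have := ltn_ord i; lia.
      by rewrite ji' /=; have := ltn_ord i; case: ifP; lia.
    have A2 : #|[set j | N false (inl i) (inr j)]| <= n.-1.
      by apply: leq_trans (max_card _) _; rewrite card_ord.
    by num_lia.
  case: a.
    have A1 : #|[set i | N true (inr j) (inl i)]| <= 1.
      apply/card_le1_eqP => i i'; rewrite !inE /N /= !eqb_id.
      by case/andP=> _ /eqP E1 /andP[_ /eqP E2]; apply/val_inj; rewrite /= E1 E2.
    have A2 : #|[set i | N true (inr j) (inr i)]| <= n.-2.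
      have -> : n.-2 = #|~: [set j]| by rewrite cardsC1 card_ord.
      apply/subset_leq_card/subsetP => i; rewrite inE /N /=.
      case/andP=> /andP[ij _] _; rewrite in_setC in_set1.
      by apply: contraNneq ij => ->.
    by num_lia.
  have A1 : #|[set i | N false (inr j) (inl i)]| <= n.-1.
    have ltj : j < n by have := ltn_ord j; lia.
    have cardj : #|~: [set Ordinal ltj]| = n.-1 by rewrite cardsC1 card_ord.
    apply: leq_trans (eq_leq cardj); apply/subset_leq_card/subsetP => i; rewrite inE /N /= eqbF_neg.
    by case/andP=> _ ij; rewrite in_setC in_set1 -val_eqE.
  have A2 : #|[set i | N false (inr j) (inr i)]| <= 0.
    by rewrite leqn0 cards_eq0; apply/eqP/setP => i; rewrite inE /N /= andbF in_set0.
  by num_lia.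
rewrite -cardT; pose h (x : complete #|T|) : complete_on T := enum_val x.
have [||c' [c'c _]] :=
  @coloring_pullback (@delete_edge (complete #|T|) (enum_rank u) (enum_rank v)) (delete_edge u v) _ h c.
- exact: enum_val_inj.
- move=> x y; rewrite complete_adjE => /andP[xy Ne]; apply/andP; split; first by rewrite /= (inj_eq enum_val_inj).
  apply: contra Ne => /eqP E; apply/eqP; apply: (imset_inj enum_val_inj).
  by rewrite !imsetU1 !imset_set1 !enum_rankK.
exists (enum_rank u), (enum_rank v), c'; split.
  by rewrite /= (inj_eq enum_rank_inj).
move=> a; apply/negP => /c'c/copy_starP[x]; apply/negP.
by rewrite -ltnNge; apply: deg.
Qed.

(* Blow-up of the 2-coloured [K_5] without monochromatic triangle: one part of
   order [m] and four of order [m.-1], each coloured internally with the third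
   colour. *)
Lemma gallai_coloring m : 0 < m ->
  exists c : coloring (complete (5 * m - 4)) 'I_3,
    gallai c /\ forall a, ~~ has_copy c a (star m.*2).
Proof.
(* [None] is the vertex by which part [ord0] exceeds the other four; colours depend on the
   difference of parts modulo 5. *)
move=> m0; pose T : finType := option ('I_5 * 'I_m.-1).
pose part (x : T) : 'I_5 := if x is Some p then p.1 else ord0.
pose f5 (i j : 'I_5) : 'I_3 := let d := (i + 5 - j) %% 5 in
  if d == 0 then @Ordinal 3 0 isT else
  if (d == 1) || (d == 4) then @Ordinal 3 1 isT else @Ordinal 3 2 isT.
have f5_sym i j : f5 i j = f5 j i.
  by case: i j => [[|[|[|[|[|i]]]]] hi] [[|[|[|[|[|j]]]]] hj].
have f5_gallai i j k : ~~ uniq [:: f5 i j; f5 j k; f5 i k].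
  by case: i j k => [[|[|[|[|[|i]]]]] hi] [[|[|[|[|[|j]]]]] hj] [[|[|[|[|[|k]]]]] hk].
have f5_deg i a : #|[set j | f5 i j == a]| <= 2.
  rewrite -sum1dep_card big_mkcond !big_ord_recl big_ord0.
  by case: i a => [[|[|[|[|[|i]]]]] hi] [[|[|[|a]]] ha].
have [|c cE] := @coloring_of (complete_on T) _ ord0 (fun x y => f5 (part x) (part y)).
  by move=> x y; apply: f5_sym.
have cardT : #|T| = 5 * m - 4 by rewrite card_option card_prod !card_ord; lia.
have deg a x : #|nbhd c a x| < m.*2.
  pose J := [set j | f5 (part x) j == a].
  (* Each colour reaches at most two parts, giving at most [2 (m-1)] neighbours besides [None]. *)
  have sub : nbhd c a x \subset None |: [set Some p | p in setX J [set: 'I_m.-1]].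
    apply/subsetP => -[[i k]|]; last by rewrite setU11.
    rewrite in_nbhd cE => /andP[_ pa]; apply/setU1r/imset_f.
    by rewrite in_setX in_setT andbT in_set.
  apply: leq_ltn_trans (subset_leq_card sub) _.
  apply: leq_ltn_trans (leq_cardsU _ _) _.
  rewrite cards1 (card_imset _ (@Some_inj _)) cardsX cardsT card_ord.
  have := leq_mul (f5_deg (part x) a) (leqnn m.-1); rewrite -/J.
  by move: (#|J| * _) => k; lia.
rewrite -cardT; pose h (x : complete #|T|) : complete_on T := enum_val x.
have [||c' [c'c gallai_c']] := @coloring_pullback (complete #|T|) _ _ h c.
- exact: enum_val_inj.
- by move=> x y xy; rewrite /= (inj_eq enum_val_inj).
exists c'; split.
  apply: gallai_c'; apply/forallP => x; apply/forallP => y; apply/forallP => z.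
  by apply/implyP => _; rewrite !cE f5_gallai.
move=> a; apply/negP => /c'c/copy_starP[x]; apply/negP.
by rewrite -ltnNge; apply: deg.
Qed.

(** * Both kinds of fullness decided *)

Lemma complete_star_plus n (c : coloring (complete n.*2.-1) bool) :
  4 <= n -> ~~ odd n -> exists a, has_copy c a (star_plus n).
Proof.
move=> n4 nev; have /orP[] : has_copy c true (star_plus n) || has_copy c false (star_plus n).
  apply: (@two_colored_clique_star_plus _ _ c true false n setT) => //.
    by rewrite cardsT card_ord.
  by move=> x y _ _ xy; rewrite !in_nbhd /= xy; case: (c _).
- by exists true.
- by exists false.
Qed.

Theorem theorem5 (n : nat) (hn : 12 <= n) (neven : ~~ odd n) :
  (ramsey_full (star n) /\ ramsey_full (star_plus n)) /\
  (~ gallai_ramsey_full (star n) /\ ~ gallai_ramsey_full (star_plus n)).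
Proof.
split.
  (* By [star_plus_star] it is enough to avoid the star and to force the subdivided star, so both
     graphs have Ramsey number [2n-1]. *)
  have [u [v [c [uv no_copy]]]] := ramsey_coloring hn neven.
  have all_copy c' := @complete_star_plus n c' (leq_trans (isT : 4 <= 12) hn) neven.
  split; apply: (ramsey_fullI (c := c) uv) => [a|c'].
  - exact: no_copy.
  - by have [a /star_plus_star aP] := all_copy c'; apply/existsP; exists a.
  - by apply: contra (no_copy a); apply: star_plus_star.
  - by have [a aP] := all_copy c'; apply/existsP; exists a.
have nE : n = n./2.*2 by rewrite even_halfK.
have m6 : 6 <= n./2 by lia.
move: (n./2) nE m6 => m -> m6.
have N1 : 1 < 5 * m - 3 by lia.
have [c [gallai_c no_copy]] : exists c : coloring (complete (5 * m - 3).-1) 'I_3,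
    gallai c /\ forall a, ~~ has_copy c a (star m.*2).
  have -> : (5 * m - 3).-1 = 5 * m - 4 by lia.
  by apply: gallai_coloring; lia.
have all_copy (u v : complete (5 * m - 3)) (c' : coloring (delete_edge u v) 'I_3) :
    gallai c' -> exists a, has_copy c' a (star_plus m.*2).
  move=> gallai_c'; apply: (missing_edge_star_plus gallai_c' _ m6); last exact: card_ord.
  exact: complete_adjE.
(* Three colours already violate fullness. *)
split=> /(_ 3 isT); apply: (not_gallai_ramsey_full_at N1 gallai_c).
- by apply/existsPn.
- move=> u v c' /all_copy[a /star_plus_star aP]; by apply/existsP; exists a.
- by apply/existsPn => a; apply: contra (no_copy a); apply: star_plus_star.
- by move=> u v c' /all_copy[a aP]; apply/existsP; exists a.
Qed.
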